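(* Let $A\in\mathbb{R}^{d\times d}$, consider the sequence $\{x_k\}$ generated by $x_{k+1}=Ax_k$ for $k\ge 0$, and let $E$ be a linear subspace of $\mathbb{R}^d$. Then the following statements are equivalent: (1) $E$ is invariant under $A$ (i.e. $x\in E\Rightarrow Ax\in E$), and $E\supseteq E_{A,\ge 1}$, where $E_{A,\ge1}$ denotes the subspace spanned by all generalized eigenvectors of $A$ corresponding to eigenvalues with modulus greater than or equal to one. (2) There exist a seminorm $p$ with $\ker(p)=E$ and constants $\alpha,\beta>0$ such that $p(x_k)\le \alpha\, p(x_0)e^{-\beta k}$ for all $k\ge 0$ and all $x_0\in\mathbb{R}^d$. (3) For any seminorm $p$ with $\ker(p)=E$, there exist constants $\alpha,\beta>0$ such that $p(x_k)\le \alpha\, p(x_0)e^{-\beta k}$ for all $k\ge0$ and all $x_0\in\mathbb{R}^d$. (4) There exist matrices $P,Q\in\mathcal{S}^d_{+,E}$ satisfying $A^\top PA-P+Q=0$. (5) For any $Q\in\mathcal{S}^d_{+,E}$, there exists a unique $P\in\mathcal{S}^d_{+,E}$ satisfying $A^\top PA-P+Q=0$. Consequently, the smallest subspace $E$ for which any of these statements holds is $E=E_{A,\ge1}$.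
   Context: A seminorm on $\mathbb{R}^d$ is a function $p:\mathbb{R}^d\to[0,\infty)$ that is absolutely homogeneous and satisfies the triangle inequality; its kernel is $\ker(p)=\{x: p(x)=0\}$. $\mathcal{S}^d_{+,E}=\{B\in\mathbb{R}^{d\times d}: B \text{ symmetric positive semi-definite},\ \ker(B)=E\}$. *)

(* Defs.v *)
From HB Require Import structures.
From mathcomp Require Import all_boot all_order all_algebra.
From mathcomp Require Import complex.
From mathcomp Require Import all_classical all_reals all_analysis.
Set Implicit Arguments. Unset Strict Implicit. Unset Printing Implicit Defensive.
Import Order.TTheory GRing.Theory Num.Theory.
Local Open Scope ring_scope.
Local Open Scope complex_scope.

Section Defs.
Variables (R : realType) (d : nat).

Definition traj (A : 'M[R]_d) (x0 : 'cV[R]_d) (k : nat) : 'cV[R]_d :=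
  iter k (mulmx A) x0.

Definition seminorm (p : 'cV[R]_d -> R) : Prop :=
  [/\ forall x, 0 <= p x,
      forall (a : R) x, p (a *: x) = `|a| * p x
    & forall x y, p (x + y) <= p x + p y].

Definition seminorm_ker_is (p : 'cV[R]_d -> R) (E : {vspace 'cV[R]_d}) : Prop :=
  forall x, p x = 0 <-> x \in E.

Definition psd_ker (E : {vspace 'cV[R]_d}) (B : 'M[R]_d) : Prop :=
  [/\ B^T = B,
      forall x : 'cV[R]_d, 0 <= (x^T *m B *m x) 0 0
    & forall x : 'cV[R]_d, B *m x = 0 <-> x \in E].

Definition cplx_mx m n (M : 'M[R]_(m, n)) : 'M[R[i]]_(m, n) :=
  map_mx (fun r : R => r%:C) M.

Definition gen_eigvec (A : 'M[R]_d) (lambda : R[i]) (v : 'cV[R[i]]_d) : Prop :=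
  v != 0 /\ exists k : nat, (cplx_mx A - lambda%:M) ^+ k *m v = 0.

Definition in_Ege1 (A : 'M[R]_d) (x : 'cV[R]_d) : Prop :=
  exists (n : nat) (c : 'I_n -> R[i]) (lam : 'I_n -> R[i]) (v : 'I_n -> 'cV[R[i]]_d),
    (forall i, 1 <= `|lam i| /\ gen_eigvec A (lam i) (v i)) /\
    cplx_mx x = \sum_(i < n) c i *: v i.

Definition stmt1 (A : 'M[R]_d) (E : {vspace 'cV[R]_d}) : Prop :=
  (forall x, x \in E -> A *m x \in E) /\ (forall x, in_Ege1 A x -> x \in E).

Definition exp_decay (A : 'M[R]_d) (p : 'cV[R]_d -> R) : Prop :=
  exists alpha beta : R, 0 < alpha /\ 0 < beta /\
    forall (k : nat) (x0 : 'cV[R]_d),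
      p (traj A x0 k) <= alpha * p x0 * expR (- (beta * k%:R)).

Definition stmt2 (A : 'M[R]_d) (E : {vspace 'cV[R]_d}) : Prop :=
  exists p, seminorm p /\ seminorm_ker_is p E /\ exp_decay A p.

Definition stmt3 (A : 'M[R]_d) (E : {vspace 'cV[R]_d}) : Prop :=
  forall p, seminorm p -> seminorm_ker_is p E -> exp_decay A p.

Definition lyap_eq (A P Q : 'M[R]_d) : Prop := A^T *m P *m A - P + Q = 0.

Definition stmt4 (A : 'M[R]_d) (E : {vspace 'cV[R]_d}) : Prop :=
  exists P Q, psd_ker E P /\ psd_ker E Q /\ lyap_eq A P Q.

Definition stmt5 (A : 'M[R]_d) (E : {vspace 'cV[R]_d}) : Prop :=
  forall Q, psd_ker E Q ->
    exists P, (psd_ker E P /\ lyap_eq A P Q) /\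
      forall P', psd_ker E P' -> lyap_eq A P' Q -> P' = P.

End Defs.

(* Main.v *)
(* The statements all say that the map induced by [A] on the quotient by [E] is
   well defined and power-contracting; let [M] be a projection with kernel [E],
   so that the norm of [M x] is a quotient norm, equivalent by compactness to
   every seminorm with kernel [E].
   If (1) holds, split complex vectors into generalized eigenvectors: [M] kills
   those with modulus at least 1, whose real and imaginary parts lie in [E], and
   the others decay geometrically, so [M A^k] does too.  Under that decay
   [P - (M A)^T P (M A)] is injective in [P], hence surjective, which solves the
   Lyapunov equation without summing a series; positivity is read off by letting
   [k] tend to infinity in [x^T P x >= (A^k x)^T P (A^k x)].  Conversely, the
   Lyapunov equation forces [P z = 0] for a generalized eigenvector [z] with
   modulus at least 1, by induction on its rank. *)
Require Import Defs.
From HB Require Import structures.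
From mathcomp Require Import all_boot all_order all_algebra.
From mathcomp Require Import complex.
From mathcomp Require Import all_classical all_reals all_analysis.
From mathcomp Require Import lra ring.
Set Implicit Arguments.
Unset Strict Implicit.
Unset Printing Implicit Defensive.
Import Order.TTheory GRing.Theory Num.Theory.
Import numFieldNormedType.Exports.
Local Open Scope ring_scope.

(** * The entrywise maximum norm and geometric bounds *)

Lemma le_mx_norm (R : realDomainType) m n (B : 'M[R]_(m, n)) i j :
  `|B i j| <= `|B|.
Proof.
rewrite [leRHS]/Num.norm /= mx_normrE.
by apply/bigmax_geP; right => /=; exists (i, j).
Qed.

Lemma mx_norm_le (R : realDomainType) m n (B : 'M[R]_(m, n)) (c : R) :
  0 <= c -> (forall i j, `|B i j| <= c) -> `|B| <= c.
Proof.
move=> c0 Bc; rewrite [leLHS]/Num.norm /= mx_normrE.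
by apply/bigmax_leP; split => // -[i j] _; exact: Bc.
Qed.

Lemma mx_norm_mulmx_le (R : realDomainType) m n l
    (B : 'M[R]_(m, n)) (D : 'M[R]_(n, l)) :
  `|B *m D| <= n%:R * `|B| * `|D|.
Proof.
apply: mx_norm_le => [|i j]; first by rewrite !mulr_ge0.
rewrite mxE (le_trans (ler_norm_sum _ _ _))//.
have -> : n%:R * `|B| * `|D| = \sum_(k < n) `|B| * `|D|.
  by rewrite sumr_const card_ord -mulrA mulr_natl.
by apply: ler_sum => k _; rewrite normrM ler_pM ?le_mx_norm.
Qed.

Lemma mx_norm_trmx_le (R : realDomainType) m n (B : 'M[R]_(m, n)) :
  `|B^T| <= `|B|.
Proof. by apply: mx_norm_le => // i j; rewrite mxE le_mx_norm. Qed.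

Lemma bilin_form_le (R : realDomainType) m n (B : 'M[R]_(m, n))
    (u : 'cV_m) (v : 'cV_n) :
  `|(u^T *m B *m v) 0 0| <= n%:R * m%:R * `|B| * (`|u| * `|v|).
Proof.
apply: le_trans (le_mx_norm _ _ _) _.
apply: le_trans (mx_norm_mulmx_le _ _) _.
have -> : n%:R * m%:R * `|B| * (`|u| * `|v|)
          = n%:R * (m%:R * `|u| * `|B|) * `|v| by ring.
rewrite ler_wpM2r// ler_wpM2l//.
apply: le_trans (mx_norm_mulmx_le _ _) _.
by rewrite ler_wpM2r// ler_wpM2l// mx_norm_trmx_le.
Qed.

Lemma le0_of_geometric_bound (R : realType) (b C r : R) : 0 <= r < 1 ->
  (forall k : nat, b <= C * r ^+ k) -> b <= 0.
Proof.
move=> /andP[r0 r1] bC.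
have r_cvg : ((GRing.exp r : nat -> R) @ \oo --> (0 : R))%classic.
  by apply: cvg_expr; rewrite ger0_norm.
have Cr_cvg : ((fun k => C * r ^+ k : R) @ \oo --> C * 0)%classic.
  exact: cvgMr.
rewrite mulr0 in Cr_cvg; rewrite -(cvg_lim _ Cr_cvg)//.
by apply: limr_ge; [apply/cvg_ex; exists 0|exact: nearW].
Qed.

(** * Seminorms against the maximum norm *)

Section SeminormFacts.
Variables (R : realType) (d : nat) (p : 'cV[R]_d -> R).
Hypothesis p_semi : seminorm p.

Lemma seminorm_ge0 x : 0 <= p x. Proof. by case: p_semi. Qed.
Lemma seminormZ a x : p (a *: x) = `|a| * p x. Proof. by case: p_semi. Qed.
Lemma seminormD x y : p (x + y) <= p x + p y. Proof. by case: p_semi. Qed.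

Lemma seminorm0 : p 0 = 0.
Proof. by rewrite -(scale0r 0) seminormZ normr0 mul0r. Qed.

Lemma seminorm_le_mx_norm : exists2 C, 0 <= C & forall x, p x <= C * `|x|.
Proof.
(* Expand [x] in the standard basis; each coordinate is at most [|x|]. *)
exists (\sum_(i < d) p (delta_mx i 0)) => [|x].
  by apply: sumr_ge0 => i _; exact: seminorm_ge0.
rewrite {1}[x]matrix_sum_delta mulr_suml.
elim/big_ind2: _ => [|x1 a x2 b ha hb|i _]; first by rewrite seminorm0.
  exact: le_trans (seminormD _ _) (lerD ha hb).
by rewrite big_ord1 seminormZ mulrC ler_wpM2l ?seminorm_ge0 ?le_mx_norm.
Qed.

(** The previous bound makes [p] Lipschitz. Row vectors are used because [bounded_closed_compact]
    concerns them. *)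
Lemma seminorm_continuous : continuous (fun v : 'rV[R]_d => p v^T).
Proof.
have [C C0 pC] := seminorm_le_mx_norm.
have pB (x y : 'rV[R]_d) : `|p x^T - p y^T| <= C * `|x - y|.
  have aux u v : p u^T - p v^T <= C * `|u - v|.
    rewrite lerBlDr; apply: (@le_trans _ _ (p (u - v)^T + p v^T)).
      by rewrite (le_trans _ (seminormD _ _))// -linearD subrK.
    rewrite lerD2r; apply: le_trans (pC _) _.
    by rewrite ler_wpM2l ?mx_norm_trmx_le.
  by rewrite ler_norml lerNl opprB {1}distrC !aux.
move=> x; apply/(@cvgrPdist_le _ _ _ _ (nbhs_filter x)) => e e0.
(* [C] may be zero, so the radius is obtained by dividing by [C + 1]. *)
have C1 : 0 < C + 1 by rewrite ltr_wpDl.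
have : nbhs x (ball x (e / (C + 1))) by apply: nbhsx_ballx; rewrite divr_gt0.
apply: filterS => y; rewrite mx_norm_ball /ball_ /= => xy.
apply: le_trans (pB x y) _; apply: (@le_trans _ _ ((C + 1) * `|x - y|)).
  by rewrite ler_wpM2r// lerDl.
by rewrite mulrC -ler_pdivlMr// ltW.
Qed.

(** The constant is the minimum of [p] on the compact unit sphere, positive because [p] vanishes
    only at 0. *)
Lemma norm_ge_mx_norm : (forall x, p x = 0 -> x = 0) ->
  exists2 c, 0 < c & forall x, c * `|x| <= p x.
Proof.
move=> p0; pose S := [set v : 'rV[R]_d | `|v| = 1]%classic.
(* An empty sphere leaves no nonzero vector to normalize (dimension 0), so any constant will do. *)
have [[v0 v0S]|Se] := pselect (S !=set0)%classic; last first.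
  exists 1 => // x; have [->|xn0] := eqVneq x 0.
    by rewrite normr0 mulr0 seminorm_ge0.
  have xT0 : `|x^T| != 0.
    by rewrite normr_eq0; apply: contra_neq xn0 => /(congr1 trmx); rewrite trmxK trmx0.
  case: Se; exists (`|x^T|^-1 *: x^T) => /=; rewrite /S /=.
  by rewrite normrZ normfV normr_id mulVf.
have cS : compact S.
  apply: bounded_closed_compact.
    by exists 1; split => // y y1 v /= ->; exact: ltW.
  have -> : S = (Num.norm @^-1` [set 1 : R])%classic by [].
  apply: closed_comp => [v _|]; [exact: norm_continuous|exact: closed_eq].
have [v vS vmin] := @compact_EVT_min _ R _ S (ex_intro _ v0 v0S) cS
  (continuous_subspaceT seminorm_continuous).
rewrite inE in vS.
exists (p v^T) => [|x].
  rewrite lt_def seminorm_ge0 andbT; apply/eqP => /p0 /(congr1 trmx).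
  rewrite trmxK trmx0 => v_0; move: vS; rewrite v_0 /S /= normr0 => /eqP.
  by rewrite eq_sym oner_eq0.
have [->|xn0] := eqVneq x 0; first by rewrite normr0 mulr0 seminorm_ge0.
have nT : `|x^T| = `|x|.
  by apply/eqP; rewrite eq_le mx_norm_trmx_le -{1}[x]trmxK mx_norm_trmx_le.
have nx : `|x| != 0 by rewrite normr_eq0.
have := vmin (`|x|^-1 *: x^T); rewrite inE /S /= normrZ normfV normr_id nT mulVf//.
move=> /(_ erefl); rewrite linearZ /= trmxK seminormZ normfV normr_id.
by rewrite mulrC ler_pdivlMr ?lt_def ?nx//= mulrC.
Qed.

End SeminormFacts.

(** * Sequences bounded by a geometric one of ratio less than 1 *)

Section GeometricDecay.
Variable R : realType.
Implicit Types a b : nat -> R.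

(** The ratio is kept strictly positive so that it can later be written as an exponential. *)
Definition geo_bounded a := exists C r : R,
  [/\ 0 <= C, 0 < r < 1 & forall k, a k <= C * r ^+ k].

Lemma geo_bounded_le a b : (forall k, a k <= b k) -> geo_bounded b -> geo_bounded a.
Proof.
move=> ab [C [r [C0 r01 bC]]]; exists C, r; split=> // k.
exact: le_trans (ab k) (bC k).
Qed.

Lemma geo_bounded0 : geo_bounded (fun=> 0).
Proof. by exists 0, (2^-1); split=> [||k]; rewrite ?mul0r// invr_gt0 invf_lt1 ?ltr0n// ltr1n. Qed.

Lemma geo_boundedD a b :
  geo_bounded a -> geo_bounded b -> geo_bounded (fun k => a k + b k).
Proof.
move=> [C [r [C0 /andP[r0 r1] aC]]] [D [s [D0 /andP[s0 s1] bD]]].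
exists (C + D), (Num.max r s); split=> [||k]; first exact: addr_ge0.
  by rewrite lt_max r0 gt_max r1.
have [rm sm] : r <= Num.max r s /\ s <= Num.max r s by rewrite !le_max !lexx orbT.
have [r0' s0' m0] : [/\ 0 <= r, 0 <= s & 0 <= Num.max r s].
  by split; rewrite ?le_max; rewrite !ltW.
rewrite mulrDl lerD//.
  by rewrite (le_trans (aC k))// ler_wpM2l// lerXn2r ?nnegrE.
by rewrite (le_trans (bD k))// ler_wpM2l// lerXn2r ?nnegrE.
Qed.

Lemma geo_bounded_sum (I : finType) (a : I -> nat -> R) :
  (forall i, geo_bounded (a i)) -> geo_bounded (fun k => \sum_i a i k).
Proof.
move=> ha; elim: (index_enum I) => [|i s IHs].
  by apply: geo_bounded_le geo_bounded0 => k; rewrite big_nil.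
by apply: geo_bounded_le (geo_boundedD (ha i) IHs) => k; rewrite big_cons.
Qed.

(** When [b] decays exactly at rate [rho], solutions can behave like [k * rho ^+ k]; a ratio [s]
    strictly between both rates and 1 absorbs the factor [k]. *)
Lemma geo_bounded_rec a b (rho : R) : 0 <= rho < 1 ->
  (forall k, a k.+1 <= rho * a k + b k) -> geo_bounded b -> geo_bounded a.
Proof.
move=> /andP[rho0 rho1] arec [C [r [C0 /andP[r0 r1] bC]]].
pose s := (Num.max r rho + 1) / 2.
have m1 : Num.max r rho < 1 by rewrite gt_max r1.
have rm : r <= Num.max r rho by rewrite le_max lexx.
have rhom : rho <= Num.max r rho by rewrite le_max lexx orbT.
have sE : s * 2 = Num.max r rho + 1 by rewrite /s mulfVK.
have [s0 s1 rs rhos] : [/\ 0 < s, s < 1, r <= s & rho < s] by split; lra.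
have srho : 0 < s - rho by rewrite subr_gt0.
(* With [D] the constant, the induction closes once [rho * D + C <= D * s], which dictates
   [C / (s - rho)]; the other term handles [k = 0]. *)
exists (`|a 0%N| + C / (s - rho)), s; split; rewrite ?s0 ?s1//.
  by rewrite addr_ge0// divr_ge0// ltW.
elim=> [|k IHk].
  by rewrite expr0 mulr1 (le_trans (ler_norm _))// lerDl divr_ge0// ltW.
apply: le_trans (arec k) _.
set D := `|a 0%N| + _ in IHk *.
have DC : C <= D * (s - rho).
  by rewrite /D mulrDl mulfVK ?gt_eqF// lerDr mulr_ge0// ltW.
apply: (@le_trans _ _ (rho * (D * s ^+ k) + D * (s - rho) * s ^+ k)).
  rewrite lerD ?ler_wpM2l// (le_trans (bC k))//.
  by rewrite ler_pM ?exprn_ge0 ?lerXn2r ?nnegrE// ?(ltW r0) ?(ltW s0).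
by rewrite exprS le_eqVlt; apply/orP; left; apply/eqP; ring.
Qed.

End GeometricDecay.

(** * Decomposition into generalized eigenvectors *)

Lemma gen_eigvec_mulmx (F : comNzRingType) d (B : 'M[F]_d) lam k (v : 'cV[F]_d) :
  (B - lam%:M) ^+ k *m v = 0 -> (B - lam%:M) ^+ k *m (B *m v) = 0.
Proof.
move=> Bv; have cB : GRing.comm B ((B - lam%:M) ^+ k).
  apply: commrX; apply: commrB => //.
  exact: scalar_mxC.
have /= <- : B * (B - lam%:M) ^+ k *m v = (B - lam%:M) ^+ k *m (B *m v).
  by rewrite cB mulmxA.
by rewrite -[B * _]/(B *m _) -mulmxA Bv mulmx0.
Qed.

(** Primary decomposition as an induction principle. The induction is on the size of a polynomial
    annihilating [v], starting from the characteristic polynomial; each round splits off one root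
    with its full multiplicity. *)
Lemma gen_eigvec_ind (F : closedFieldType) d (B : 'M[F]_d) (P : 'cV[F]_d -> Prop) :
    P 0 -> (forall x y, P x -> P y -> P (x + y)) ->
    (forall lam k v, (B - lam%:M) ^+ k *m v = 0 -> P v) ->
  forall z, P z.
Proof.
case: d B P => [|d] B P P0 PD Pgen z; first by rewrite [z]flatmx0.
suff Pann n (p : {poly F}) v : (size p <= n)%N -> p != 0 -> horner_mx B p *m v = 0 -> P v.
  apply: (Pann _ (char_poly B)) => //; last by rewrite Cayley_Hamilton mul0mx.
  exact: monic_neq0 (char_poly_monic B).
elim: n p v => [|n IHn] p v pn p0 pv.
  by move: p0; rewrite -size_poly_eq0 -leqn0 pn.
have [/size_poly1P[c c0 pE]|/closed_rootP[lam lam_root]] := boolP (size p == 1%N).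
  move: pv; rewrite pE horner_mx_C mul_scalar_mx => /eqP.
  by rewrite scaler_eq0 (negbTE c0) => /eqP->.
have [m [q]] := multiplicity_XsubC p lam; rewrite p0 /= => qlam pE.
have q0 : q != 0 by apply: contraNneq p0 => q0; rewrite pE q0 mul0r.
have m0 : (0 < m)%N.
  by rewrite lt0n; apply: contraNneq qlam => m0; move: lam_root; rewrite pE m0 mulr1.
have XBE : horner_mx B (('X - lam%:P) ^+ m) = (B - lam%:M) ^+ m.
  by rewrite rmorphXn rmorphB /= horner_mx_X horner_mx_C.
have /Bezout_eq1_coprimepP[[u w] /= uw] : coprimep (('X - lam%:P) ^+ m) q.
  by apply: coprimep_expl; rewrite coprimep_sym coprimep_XsubC.
(* By Bezout, the first summand is annihilated by the smaller polynomial [q], the second by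
   [('X - lam%:P) ^+ m]. *)
have -> : v = horner_mx B (u * ('X - lam%:P) ^+ m) *m v + horner_mx B (w * q) *m v.
  by rewrite -mulmxDl -rmorphD uw rmorph1 mul1mx.
have kill s : horner_mx B (s * p) *m v = 0.
  by rewrite rmorphM -[_ * horner_mx B p]/(_ *m _) -mulmxA pv mulmx0.
apply: PD; last first.
  apply: (Pgen lam m); rewrite -XBE mulmxA mulmxE -rmorphM.
  by rewrite mulrC -mulrA -pE kill.
apply: (IHn q) => //.
  rewrite -ltnS (leq_trans _ pn)// pE size_Mmonic ?monic_exp ?monicXsubC//.
  by rewrite size_exp_XsubC addnS /= -[ltnLHS]addn0 ltn_add2l.
by rewrite mulmxA mulmxE -rmorphM mulrCA -pE kill.
Qed.

(** * Complex vectors as pairs of real ones, and the span for modulus at least 1 *)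

Section Complexification.
Local Open Scope complex_scope.
Variables (R : realType) (d : nat).
Local Notation C := R[i].
Implicit Types (A B : 'M[R]_d) (z : 'cV[C]_d).

Definition cplx_pair m n (a b : 'M[R]_(m, n)) : 'M[C]_(m, n) :=
  \matrix_(i, j) (a i j +i* b i j).

Lemma cplx_pair_inj m n (a b a' b' : 'M[R]_(m, n)) :
  cplx_pair a b = cplx_pair a' b' -> a = a' /\ b = b'.
Proof.
move=> /matrixP ab; split; apply/matrixP => i j;
  by have := ab i j; rewrite !mxE => -[].
Qed.

Lemma cplx_pairP m n (z : 'M[C]_(m, n)) : exists a b, z = cplx_pair a b.
Proof.
exists (map_mx (@complex.Re R) z), (map_mx (@complex.Im R) z).
by apply/matrixP => i j; rewrite !mxE; case: (z i j).
Qed.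

Lemma cplx_pair0 m n : cplx_pair (0 : 'M[R]_(m, n)) 0 = 0.
Proof. by apply/matrixP => i j; rewrite !mxE. Qed.

Lemma cplx_pairD m n (a b a' b' : 'M[R]_(m, n)) :
  cplx_pair a b + cplx_pair a' b' = cplx_pair (a + a') (b + b').
Proof. by apply/matrixP => i j; rewrite !mxE. Qed.

Lemma cplx_pairZ m n (s t : R) (a b : 'M[R]_(m, n)) :
  (s +i* t) *: cplx_pair a b = cplx_pair (s *: a - t *: b) (s *: b + t *: a).
Proof. by apply/matrixP => i j; rewrite !mxE. Qed.

Lemma cplx_mxE m n (a : 'M[R]_(m, n)) : cplx_mx a = cplx_pair a 0.
Proof. by apply/matrixP => i j; rewrite !mxE. Qed.

Lemma mul_cplx_pair m n l (B : 'M[R]_(m, n)) (a b : 'M[R]_(n, l)) :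
  cplx_mx B *m cplx_pair a b = cplx_pair (B *m a) (B *m b).
Proof.
apply/matrixP => i j; rewrite !mxE.
elim/big_rec3: _ => [//|k x y z _ ->]; rewrite !mxE.
by apply/eqP; rewrite eq_complex /= !mul0r subr0 addr0 !eqxx.
Qed.

Lemma cplx_mxM m n l (a : 'M[R]_(m, n)) (b : 'M[R]_(n, l)) :
  cplx_mx (a *m b) = cplx_mx a *m cplx_mx b.
Proof. by rewrite [cplx_mx b]cplx_mxE mul_cplx_pair mulmx0 cplx_mxE. Qed.

Lemma cplx_mxX A k : cplx_mx (A ^+ k) = cplx_mx A ^+ k.
Proof.
elim: k => [|k IHk]; last by rewrite !exprS -IHk -[RHS]cplx_mxM.
by apply/matrixP => i j; rewrite !mxE; case: eqP.
Qed.

(** Unlike in [gen_eigvec], [z = 0] is allowed, which gives stability under all scalars. *)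
Definition ge1_eigvec A z :=
  exists lam k, 1 <= `|lam| /\ (cplx_mx A - lam%:M) ^+ k *m z = 0.

(** An inductive span replaces indexed sums by structural induction; scaling needs no constructor,
    since the generators are stable under it. *)
Inductive ge1_span A : 'cV[C]_d -> Prop :=
| ge1_span0 : ge1_span A 0
| ge1_spanD x y : ge1_span A x -> ge1_span A y -> ge1_span A (x + y)
| ge1_span_gen z : ge1_eigvec A z -> ge1_span A z.

Lemma ge1_eigvecZ A c z : ge1_eigvec A z -> ge1_eigvec A (c *: z).
Proof.
by move=> [lam [k [lam1 Az]]]; exists lam, k; rewrite -scalemxAr Az scaler0.
Qed.

Lemma ge1_spanZ A c z : ge1_span A z -> ge1_span A (c *: z).
Proof.
elim=> [|x y _ IHx _ IHy|x Ax]; first by rewrite scaler0; exact: ge1_span0.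
  by rewrite scalerDr; exact: ge1_spanD.
exact/ge1_span_gen/ge1_eigvecZ.
Qed.

Lemma ge1_span_mulmx A z : ge1_span A z -> ge1_span A (cplx_mx A *m z).
Proof.
elim=> [|x y _ IHx _ IHy|x [lam [k [lam1 Ax]]]].
- by rewrite mulmx0; exact: ge1_span0.
- by rewrite mulmxDr; exact: ge1_spanD.
by apply/ge1_span_gen; exists lam, k; split=> //; exact: gen_eigvec_mulmx.
Qed.

Lemma in_Ege1P A (x : 'cV[R]_d) : in_Ege1 A x <-> ge1_span A (cplx_mx x).
Proof.
split=> [[n [c [lam [v [v_eig ->]]]]]|].
  elim/big_ind: _ => [||i _]; [exact: ge1_span0|exact: ge1_spanD|].
  have [lam1 [_ [k Av]]] := v_eig i.
  by apply/ge1_spanZ/ge1_span_gen; exists (lam i), k.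
rewrite /in_Ege1; elim=> [|y z _ [n [c [lam [v [v_eig ->]]]]]
    _ [m [c' [lam' [v' [v'_eig ->]]]]]|z [lam [k [lam1 Az]]]].
- exists 0%N, (fun=> 0), (fun=> 0), (fun=> 0); split=> [[]//|].
  by rewrite big_ord0.
- pose glue T (f : 'I_n -> T) (g : 'I_m -> T) (i : 'I_(n + m)) :=
    match fintype.split i with inl j => f j | inr j => g j end.
  exists (n + m)%N, (glue _ c c'), (glue _ lam lam'), (glue _ v v'); split=> [i|].
    by rewrite /glue; case: (fintype.split i) => j; [exact: v_eig|exact: v'_eig].
  rewrite big_split_ord; congr (_ + _); apply: eq_bigr => i _.
    by rewrite /glue -[lshift m i]/(unsplit (inl i)) unsplitK.
  by rewrite /glue -[rshift n i]/(unsplit (inr i)) unsplitK.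
(* The zero vector is not a [gen_eigvec], so it is represented by the empty sum. *)
have [->|z0] := eqVneq z 0.
  exists 0%N, (fun=> 0), (fun=> 0), (fun=> 0); split=> [[]//|].
  by rewrite big_ord0.
exists 1%N, (fun=> 1), (fun=> lam), (fun=> z); split=> [_|].
  by split=> //; split=> //; exists k.
by rewrite big_ord1 scale1r.
Qed.

Lemma in_Ege1_mulmx A x : in_Ege1 A x -> in_Ege1 A (A *m x).
Proof.
move=> /in_Ege1P Ax; apply/in_Ege1P; rewrite cplx_mxM.
exact: ge1_span_mulmx.
Qed.

(* The conjugate of a generalized eigenvector for [lam] is one for [lam^*], so
   the real and imaginary parts stay in the span. *)
Lemma in_Ege1_pair A (a b : 'cV[R]_d) :
  ge1_eigvec A (cplx_pair a b) -> in_Ege1 A a /\ in_Ege1 A b.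
Proof.
move=> Aab; have Aab' : ge1_eigvec A (cplx_pair a (- b)).
  have conjE m n (u v : 'M[R]_(m, n)) :
      map_mx (@conjc R) (cplx_pair u v) = cplx_pair u (- v).
    by apply/matrixP => i j; rewrite !mxE.
  have conjA : map_mx (@conjc R) (cplx_mx A) = cplx_mx A.
    by rewrite cplx_mxE conjE oppr0.
  have [lam [k [lam1 Az]]] := Aab.
  exists lam^*, k; split; first by rewrite normcJ.
  rewrite -conjE -conjA -map_scalar_mx -map_mxB.
  have mapX (B : 'M[C]_d) : map_mx (@conjc R) B ^+ k = map_mx (@conjc R) (B ^+ k).
    elim: (k) => [|l IHl]; last by rewrite !exprS IHl -[_ * _]map_mxM.
    by rewrite map_mx1.
  by rewrite mapX -map_mxM Az map_mx0.
split; apply/in_Ege1P; rewrite cplx_mxE.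
  have -> : cplx_pair a 0 =
      (2^-1 +i* 0) *: cplx_pair a b + (2^-1 +i* 0) *: cplx_pair a (- b).
    rewrite !cplx_pairZ cplx_pairD; congr cplx_pair; apply/matrixP => i j;
      by rewrite !mxE; field.
  by apply: ge1_spanD; apply/ge1_spanZ/ge1_span_gen.
have -> : cplx_pair b 0 =
    (0 -i* 2^-1) *: cplx_pair a b + (0 +i* 2^-1) *: cplx_pair a (- b).
  rewrite !cplx_pairZ cplx_pairD; congr cplx_pair; apply/matrixP => i j;
    by rewrite !mxE; field.
by apply: ge1_spanD; apply/ge1_spanZ/ge1_span_gen.
Qed.

End Complexification.

(** * Decay on the generalized eigenvectors of modulus less than 1 *)

Section ComplexDecay.
Variables (R : realType) (d : nat).
Local Notation C := (R[i])%C.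
Implicit Types (A M : 'M[R]_d) (z : 'cV[C]_d).

(** A norm with values in [R], as [geo_bounded] requires; the generic norm over [R[i]] is itself
    complex-valued. *)
Definition cnorm z : R := \sum_i Normc.normc (z i 0).

Lemma normc_ge0 (x : C) : 0 <= Normc.normc x.
Proof. by case: x => a b; rewrite /= sqrtr_ge0. Qed.

Lemma cnorm0 : cnorm 0 = 0.
Proof. by rewrite /cnorm big1// => i _; rewrite mxE Normc.normc0. Qed.

Lemma cnormD z1 z2 : cnorm (z1 + z2) <= cnorm z1 + cnorm z2.
Proof.
by rewrite /cnorm -big_split /=; apply: ler_sum => i _; rewrite mxE le_normcD.
Qed.

Lemma cnormZ c z : cnorm (c *: z) = Normc.normc c * cnorm z.
Proof. by rewrite /cnorm mulr_sumr; apply: eq_bigr => i _; rewrite mxE Normc.normcM. Qed.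

Lemma le_cnorm_cplx_mx (x : 'cV[R]_d) i : `|x i 0| <= cnorm (cplx_mx x).
Proof.
rewrite /cnorm (bigD1 i)//= mxE /= expr0n /= addr0 sqrtr_sqr lerDl.
by apply: sumr_ge0 => k _; exact: normc_ge0.
Qed.

(** For modulus at least 1, [A ^+ k] preserves the generalized eigenspace and [M] kills it.
    Otherwise, by induction on the rank, [A^(k+1) z = lam A^k z + A^k (A - lam) z] is a recurrence
    whose forcing term already decays. *)
Lemma gen_eigvec_decay A M :
    (forall z, ge1_eigvec A z -> cplx_mx M *m z = 0) ->
  forall z, geo_bounded (fun k => cnorm (cplx_mx M *m (cplx_mx A ^+ k *m z))).
Proof.
move=> MA0; apply: (gen_eigvec_ind (B := cplx_mx A)).
- by apply: geo_bounded_le (geo_bounded0 R) => k; rewrite !mulmx0 cnorm0.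
- move=> x y hx hy; apply: geo_bounded_le (geo_boundedD hx hy) => k.
  by rewrite !mulmxDr cnormD.
move=> lam m; have [lam1|lam1] := leP 1 (Normc.normc lam).
  move=> z Az; apply: geo_bounded_le (geo_bounded0 R) => k.
  have -> : cplx_mx M *m (cplx_mx A ^+ k *m z) = 0; last by rewrite cnorm0.
  apply: MA0; exists lam, m; split; first by rewrite -[1]/(1%:C)%C lecR.
  elim: k => [|k IHk]; first by rewrite expr0 mul1mx.
  by rewrite exprS -[_ * _]/(_ *m _) -mulmxA; exact: gen_eigvec_mulmx.
elim: m => [|m IHm] z Az.
  move: Az; rewrite expr0 mul1mx => ->.
  by apply: geo_bounded_le (geo_bounded0 R) => k; rewrite !mulmx0 cnorm0.
apply: (@geo_bounded_rec _ _ _ (Normc.normc lam)); last first.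
- apply: (IHm ((cplx_mx A - lam%:M) *m z)).
  by rewrite mulmxA -[_ *m (_ - _)]/(_ * _) -exprSr.
- move=> k; rewrite -cnormZ; apply: le_trans (cnormD _ _).
  rewrite exprSr -[_ * _]/(_ *m _) -mulmxA scalemxAr scalemxAr -!mulmxDr.
  by rewrite mulmxBl mul_scalar_mx subrKC.
- by rewrite normc_ge0.
Qed.

Lemma mx_geo_decay A M :
    (forall z, ge1_eigvec A z -> cplx_mx M *m z = 0) ->
  geo_bounded (fun k => `|M *m A ^+ k|).
Proof.
move=> MA0; pose a (j : 'I_d) k :=
  cnorm (cplx_mx M *m (cplx_mx A ^+ k *m cplx_mx (delta_mx j 0))).
apply: (@geo_bounded_le _ _ (fun k => \sum_j a j k)) => [k|]; last first.
  by apply: geo_bounded_sum => j; exact: gen_eigvec_decay.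
have a0 j : 0 <= a j k by apply: sumr_ge0 => i _; exact: normc_ge0.
apply: mx_norm_le => [|i j]; first exact: sumr_ge0.
rewrite (bigD1 j)//= (@le_trans _ _ (a j k))//; last first.
  by rewrite lerDl; exact: sumr_ge0.
have -> : (M *m A ^+ k) i j = (M *m (A ^+ k *m (delta_mx j 0 : 'cV_d))) i 0.
  by rewrite mulmxA -colE [RHS]mxE.
apply: le_trans (le_cnorm_cplx_mx _ _) _.
by rewrite /a !cplx_mxM cplx_mxX.
Qed.

End ComplexDecay.

(** * The quotient by [E] and statements (1) to (3) *)

Section Subspaces.
Variables (R : realType) (d : nat).
Implicit Types (A B M P Q : 'M[R]_d) (x y : 'cV[R]_d) (E : {vspace 'cV[R]_d}).

(** Take a subspace of maximal dimension inside [P]: adding the line of a vector satisfying [P]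
    cannot enlarge it. *)
Lemma vspace_of_submodule (P : 'cV[R]_d -> Prop) :
    P 0 -> (forall x y, P x -> P y -> P (x + y)) ->
    (forall a x, P x -> P (a *: x)) ->
  exists U : {vspace 'cV[R]_d}, forall x, x \in U <-> P x.
Proof.
move=> P0 PD PZ.
pose sub (U : {vspace 'cV[R]_d}) := forall x, x \in U -> P x.
pose dims n := `[< exists2 U, sub U & (\dim U = n)%N >].
have dims0 : exists n, dims n.
  exists 0%N; apply/asboolP; exists 0%VS; last exact: dimv0.
  by move=> x; rewrite memv0 => /eqP->.
have dimsle n : dims n -> (n <= \dim {:'cV[R]_d})%N.
  by move=> /asboolP[U _ <-]; apply: dimvS; exact: subvf.
case: (ex_maxnP dims0 dimsle) => n /asboolP[U subU dimU] nmax.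
exists U => x; split; first exact: subU.
move=> Px; have subUx : sub (U + <[x]>)%VS.
  by move=> _ /memv_addP[u uU [_ /vlineP[k ->] ->]]; apply: PD; [exact: subU|exact: PZ].
have : dims (\dim (U + <[x]>)) by apply/asboolP; exists (U + <[x]>)%VS.
move=> /nmax; rewrite -dimU => dimle.
have /eqP-> : U == (U + <[x]>)%VS by rewrite eqEdim addvSl.
by rewrite (subvP (addvSr _ _))// memv_line.
Qed.

(* [M] realizes the quotient by [E] inside the space itself. *)
Definition projects_along E M :=
  M *m M = M /\ forall x, M *m x = 0 <-> x \in E.

Lemma projects_along_exists E : exists M, projects_along E M.
Proof.
(* The complement of the projection onto [E], transposed because [lin1_mx] acts on rows. *)
pose f (v : 'rV[R]_d) : 'rV[R]_d := (v^T - projv E v^T)^T.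
have f_lin : linear f.
  move=> a u v; apply/trmx_inj; rewrite /f trmxK !(linearD, linearZ) /= !trmxK.
  by rewrite scalerDr addrACA.
pose fL := GRing.isLinear.Build _ _ _ _ f f_lin.
pose F : {linear 'rV[R]_d -> 'rV[R]_d} := HB.pack f fL.
exists (lin1_mx F)^T.
have ME x : (lin1_mx F)^T *m x = x - projv E x.
  by rewrite -[x in LHS]trmxK -trmx_mul mul_rV_lin1 /= /f !trmxK.
split.
  apply/trmx_inj/row_matrixP => i; apply: trmx_inj.
  rewrite -!tr_col !trmxK !colE -mulmxA !ME.
  by rewrite linearB /= projv_proj subrr subr0.
move=> x; rewrite ME; split=> [/eqP|xE]; last by rewrite projv_id ?subrr.
by rewrite subr_eq0 => /eqP->; exact: memv_proj.
Qed.

Lemma proj_ker E M x : projects_along E M -> x - M *m x \in E.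
Proof. by move=> [MM ME]; apply/ME; rewrite mulmxBr mulmxA MM subrr. Qed.

Lemma seminorm_proj E M p x : projects_along E M -> seminorm p ->
  seminorm_ker_is p E -> p (M *m x) = p x.
Proof.
move=> ME p_semi pE; have px0 := (pE _).2 (proj_ker x ME).
apply/eqP; rewrite eq_le; apply/andP; split.
  rewrite -{1}(subKr x (M *m x)) (le_trans (seminormD p_semi _ _))//.
  by rewrite -scaleN1r seminormZ// px0 mulr0 addr0.
rewrite -{1}(subrK (M *m x) x) (le_trans (seminormD p_semi _ _))//.
by rewrite px0 add0r.
Qed.

(** Adding [|x - M x|] to [p] gives a genuine norm, bounded below by compactness; at [M x] the added
    term vanishes, and [p (M x) = p x]. *)
Lemma seminorm_equiv E M p : projects_along E M -> seminorm p ->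
    seminorm_ker_is p E ->
  exists c C, [/\ 0 < c, 0 <= C &
    forall x, c * `|M *m x| <= p x /\ p x <= C * `|M *m x|].
Proof.
move=> ME p_semi pE.
have [C C0 pC] := seminorm_le_mx_norm p_semi.
pose q x := p x + `|x - M *m x|.
have q_semi : seminorm q.
  split=> [x|a x|x y]; first by rewrite addr_ge0// seminorm_ge0.
    by rewrite /q seminormZ// -scalemxAr -scalerBr normrZ mulrDr.
  rewrite /q mulmxDr opprD addrACA [leRHS]addrACA lerD//; first exact: seminormD.
  exact: ler_normD.
have q0 x : q x = 0 -> x = 0.
  move=> /eqP; rewrite /q paddr_eq0 ?(seminorm_ge0 p_semi)//.
  by move=> /andP[/eqP/pE/(ME.2 _).2 -> /eqP/normr0_eq0]; rewrite subr0.
have [c c0 qc] := norm_ge_mx_norm q_semi q0.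
exists c, C; split=> // x; rewrite -(seminorm_proj x ME p_semi pE); split=> //.
apply: le_trans (qc _) _.
by rewrite /q mulmxA ME.1 subrr normr0 addr0.
Qed.

Lemma trajE A x k : traj A x k = A ^+ k *m x.
Proof.
elim: k => [|k IHk]; first by rewrite expr0 mul1mx.
by rewrite exprS /traj iterS -/(traj A x k) IHk mulmxA.
Qed.

(* Decay of the dynamics induced by [A] on the quotient by [ker M]; taking
   [k = 1] it also makes [ker M] invariant. *)
Definition quotient_decay A M := exists C r : R,
  [/\ 0 <= C, 0 < r < 1 &
      forall k x, `|M *m (A ^+ k *m x)| <= C * r ^+ k * `|M *m x|].

(** The vector [x - M x] lies in [E], and so does its image under [A ^+ k], which [M] then kills. *)
Lemma proj_mulmx_exp A E M k : projects_along E M ->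
  (forall x, x \in E -> A *m x \in E) -> M *m A ^+ k *m M = M *m A ^+ k.
Proof.
move=> ME AE; have AkE x : x \in E -> A ^+ k *m x \in E.
  move=> xE; elim: k => [|k IHk]; first by rewrite expr0 mul1mx.
  by rewrite exprS -[_ * _]/(_ *m _) -mulmxA; exact: AE.
apply/eqP; rewrite eq_sym -subr_eq0; apply/eqP.
rewrite -{1}[M *m A ^+ k]mulmx1 -mulmxBr.
apply/trmx_inj/row_matrixP => i; apply: trmx_inj.
rewrite -!tr_col !trmxK !colE mul0mx -mulmxA mulmxBl mul1mx -mulmxA.
exact: (ME.2 _).2 (AkE _ (proj_ker _ ME)).
Qed.

Lemma stmt1_quotient_decay A E M : projects_along E M ->
  stmt1 A E -> quotient_decay A M.
Proof.
move=> ME [AE E1].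
have [z|C [r [C0 r01 MAk]]] := @mx_geo_decay R d A M.
  have [a [b ->]] := cplx_pairP z => /in_Ege1_pair[/E1/ME.2 a0 /E1/ME.2 b0].
  by rewrite mul_cplx_pair a0 b0 cplx_pair0.
have r0 : 0 <= r by case/andP: r01 => /ltW.
exists (d%:R * C), r; split=> [||k x]; rewrite ?mulr_ge0//.
(* Inserting [M] on the right turns a bound by [|x|] into one by [|M x|]. *)
rewrite mulmxA -(proj_mulmx_exp k ME AE) -mulmxA.
apply: le_trans (mx_norm_mulmx_le _ _) _.
by rewrite ler_wpM2r// -mulrA ler_wpM2l.
Qed.

Lemma quotient_decay_invariant A E M x : projects_along E M ->
  quotient_decay A M -> x \in E -> A *m x \in E.
Proof.
move=> ME [C [r [_ _ /(_ 1%N x) MAx]]] /(ME.2 _).2 Mx; apply/(ME.2 _).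
by move: MAx; rewrite Mx normr0 mulr0 expr1 normr_le0 => /eqP.
Qed.

Lemma quotient_decay_stmt3 A E M : projects_along E M ->
  quotient_decay A M -> stmt3 A E.
Proof.
move=> ME [C [r [C0 /andP[r0 r1] MAk]]] p p_semi pE.
have [c [D [c0 D0 pM]]] := seminorm_equiv ME p_semi pE.
(* The [+ 1] ensures [alpha > 0], as [D * C] may vanish; [beta] makes [expR (- beta)] equal to
   [r]. *)
exists (D * C / c + 1), (- ln r); split; last split.
- by rewrite ltr_wpDl// divr_ge0 ?mulr_ge0// ltW.
- by rewrite oppr_gt0 ln_lt0// r0.
move=> k x; rewrite mulNr opprK expRM_natr lnK ?posrE// trajE.
apply: le_trans (pM _).2 _.
apply: (@le_trans _ _ (D * C / c * p x * r ^+ k)); last first.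
  by rewrite ler_wpM2r ?exprn_ge0 ?(ltW r0)// ler_wpM2r ?seminorm_ge0// lerDl.
apply: (@le_trans _ _ (D * (C * r ^+ k * `|M *m x|))).
  by rewrite ler_wpM2l.
have -> : D * C / c * p x * r ^+ k = D * (C * r ^+ k * (p x / c)) by ring.
rewrite ler_wpM2l// ler_wpM2l ?mulr_ge0 ?exprn_ge0 ?(ltW r0)//.
by rewrite ler_pdivlMr// mulrC (pM _).1.
Qed.

Lemma stmt3_stmt2 A E : stmt3 A E -> stmt2 A E.
Proof.
have [M ME] := projects_along_exists E => AE.
have p_semi : seminorm (fun x => `|M *m x|).
  split=> // [a x|x y]; first by rewrite -scalemxAr normrZ.
  by rewrite mulmxDr ler_normD.
have pE : seminorm_ker_is (fun x => `|M *m x|) E.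
  by move=> x; rewrite -(ME.2 x); split=> [/normr0P/eqP|->]; rewrite ?normr0.
by exists (fun x => `|M *m x|); split; last by split; [exact: pE|exact: AE].
Qed.

Lemma stmt2_quotient_decay A E M : projects_along E M ->
  stmt2 A E -> quotient_decay A M.
Proof.
move=> ME [p [p_semi [pE [alpha [beta [a0 [b0 pA]]]]]]].
have [c [D [c0 D0 pM]]] := seminorm_equiv ME p_semi pE.
exists (alpha * D / c), (expR (- beta)); split=> [||k x].
- by rewrite divr_ge0 ?mulr_ge0// ltW.
- by rewrite expR_gt0 expR_lt1 oppr_lt0.
rewrite -(ler_pM2l c0); apply: le_trans (pM _).1 _.
rewrite -trajE; apply: le_trans (pA k x) _.
rewrite -mulNr expRM_natr.
have -> : c * (alpha * D / c * expR (- beta) ^+ k * `|M *m x|)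
    = alpha * (D * `|M *m x|) * expR (- beta) ^+ k by field; rewrite gt_eqF.
by rewrite ler_wpM2r ?exprn_ge0 ?expR_ge0// ler_wpM2l ?(ltW a0)// (pM _).2.
Qed.

End Subspaces.

(** * Quadratic forms and the Lyapunov equation, statements (4) and (5) *)

Section Lyapunov.
Variables (R : realType) (d : nat).
Implicit Types (A B M P Q : 'M[R]_d) (x y : 'cV[R]_d) (E : {vspace 'cV[R]_d}).

Definition bilin_form B x y : R := (x^T *m B *m y) 0 0.
Definition quad_form B x : R := bilin_form B x x.

Lemma bilin_formDl B x x' y :
  bilin_form B (x + x') y = bilin_form B x y + bilin_form B x' y.
Proof. by rewrite /bilin_form [(x + x')^T]linearD /= !mulmxDl mxE. Qed.

Lemma bilin_formDr B x y y' :
  bilin_form B x (y + y') = bilin_form B x y + bilin_form B x y'.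
Proof. by rewrite /bilin_form mulmxDr mxE. Qed.

Lemma bilin_formZl B a x y : bilin_form B (a *: x) y = a * bilin_form B x y.
Proof. by rewrite /bilin_form [(a *: x)^T]linearZ /= -!scalemxAl mxE. Qed.

Lemma bilin_formZr B a x y : bilin_form B x (a *: y) = a * bilin_form B x y.
Proof. by rewrite /bilin_form -scalemxAr mxE. Qed.

Lemma bilin_formC B x y : B^T = B -> bilin_form B x y = bilin_form B y x.
Proof.
move=> BT; rewrite /bilin_form.
have <- : (y^T *m B *m x)^T = x^T *m B *m y by rewrite !trmx_mul trmxK BT mulmxA.
by rewrite mxE.
Qed.

Definition bilin_formE := (bilin_formDl, bilin_formDr, bilin_formZl, bilin_formZr).

Lemma dot_eq0 x : (x^T *m x) 0 0 = 0 -> x = 0.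
Proof.
rewrite mxE => /eqP; rewrite psumr_eq0 => [|i _]; last by rewrite mxE -expr2 sqr_ge0.
move=> /allP x0; apply/matrixP => i j; rewrite ord1 mxE.
have := x0 i (mem_index_enum i); rewrite implyTb mxE -expr2 sqrf_eq0.
by move=> /eqP.
Qed.

(** Moving from [x] by [t * B x] changes the form at first order by [2 t |B x|^2] (Euclidean), so a
    small negative [t] would make it negative unless [B x = 0]. *)
Lemma psd_form_eq0 B x : B^T = B -> (forall y, 0 <= quad_form B y) ->
  quad_form B x = 0 -> B *m x = 0.
Proof.
move=> BT B0 xB; set y := B *m x.
apply: dot_eq0; set a := (y^T *m y) 0 0; pose c := quad_form B y.
have c0 : 0 <= c := B0 y.
have quadE t : quad_form B (x + t *: y) = 2 * t * a + t ^+ 2 * c.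
  have yx : bilin_form B y x = a by rewrite /bilin_form -mulmxA.
  rewrite /quad_form !bilin_formE (bilin_formC x y BT) yx.
  by rewrite -/(quad_form B x) xB /c /quad_form; ring.
(* The minimizer would be [- a / c]; [c + 1] avoids a zero denominator and still gives a negative
   value unless [a = 0]. *)
have := B0 (x + (- a / (c + 1)) *: y); rewrite quadE.
have c1 : 0 < c + 1 by rewrite ltr_wpDl.
have -> : 2 * (- a / (c + 1)) * a + (- a / (c + 1)) ^+ 2 * c =
   - (a ^+ 2 * (c + 2) / (c + 1) ^+ 2) by field; rewrite gt_eqF.
rewrite oppr_ge0 pmulr_lle0 ?invr_gt0 ?exprn_gt0// pmulr_lle0 ?ltr_wpDl//.
by move=> a2; apply/eqP; rewrite -sqrf_eq0 eq_le a2 sqr_ge0.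
Qed.

Lemma lyap_form A P Q x : lyap_eq A P Q ->
  quad_form P x = quad_form P (A *m x) + quad_form Q x.
Proof.
rewrite /lyap_eq addrAC => /eqP; rewrite subr_eq0 => /eqP PE.
by rewrite /quad_form /bilin_form -{1}PE mulmxDr mulmxDl mxE trmx_mul !mulmxA.
Qed.

(** The sandwich identity means that [P] sees only the projected vectors, and each of the two
    arguments contributes a factor [r ^+ k]. *)
Lemma quotient_decay_form A M P : quotient_decay A M -> M^T *m P *m M = P ->
  exists K s : R, 0 <= s < 1 /\ forall k x y,
    `|((A ^+ k *m x)^T *m P *m (A ^+ k *m y)) 0 0| <= K * `|M *m x| * `|M *m y| * s ^+ k.
Proof.
move=> [C [r [C0 /andP[r0 r1] MA]]] PE.
exists (d%:R * d%:R * `|P| * C ^+ 2), (r ^+ 2); split=> [|k x y].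
  by rewrite sqr_ge0 expr_lt1// ltW.
have -> : (A ^+ k *m x)^T *m P *m (A ^+ k *m y) =
    (M *m (A ^+ k *m x))^T *m P *m (M *m (A ^+ k *m y)).
  by rewrite -{1}PE [in RHS]trmx_mul !mulmxA.
apply: le_trans (bilin_form_le _ _ _) _.
have -> : d%:R * d%:R * `|P| * C ^+ 2 * `|M *m x| * `|M *m y| * (r ^+ 2) ^+ k =
    d%:R * d%:R * `|P| * ((C * r ^+ k * `|M *m x|) * (C * r ^+ k * `|M *m y|)).
  by rewrite exprAC; ring.
by rewrite ler_wpM2l ?mulr_ge0// ler_pM.
Qed.

(** The form of [P] is constant along trajectories and also tends to 0, so every entry vanishes. *)
Lemma lyap_fixed_eq0 A M P : quotient_decay A M -> M^T *m P *m M = P ->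
  A^T *m P *m A = P -> P = 0.
Proof.
move=> MA PM PA; have [K [s [s01 PK]]] := quotient_decay_form MA PM.
have PAk k x y : (A ^+ k *m x)^T *m P *m (A ^+ k *m y) = x^T *m P *m y.
  elim: k => [|k IHk]; first by rewrite expr0 !mul1mx.
  rewrite exprS -[A * _]/(A *m _) -!(mulmxA A) trmx_mul -[RHS]IHk -{2}PA.
  by rewrite !mulmxA.
apply/matrixP => i j; rewrite [RHS]mxE.
apply/eqP; rewrite -normr_le0; pose e l : 'cV[R]_d := delta_mx l 0.
apply: (le0_of_geometric_bound (C := K * `|M *m e i| * `|M *m e j|) s01) => k.
have -> : P i j = ((e i)^T *m P *m e j) 0 0.
  by rewrite trmx_delta -rowE -colE !mxE.
by rewrite -(PAk k).
Qed.

Lemma psd_ker_sandwich E M P : projects_along E M -> psd_ker E P ->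
  M^T *m P *m M = P.
Proof.
move=> ME [PT _ PE].
have PM : P *m M = P.
  apply/eqP; rewrite eq_sym -subr_eq0 -{1}[P]mulmx1 -mulmxBr; apply/eqP.
  apply/trmx_inj/row_matrixP => i; apply: trmx_inj.
  rewrite -!tr_col !trmxK !colE mul0mx -mulmxA mulmxBl mul1mx.
  exact: (PE _).2 (proj_ker _ ME).
by rewrite -mulmxA PM -{1}PT -trmx_mul PM PT.
Qed.

(** With [A] itself, [P - A^T P A] can fail to be injective on all matrices, because of [A] on [E].
    With [N = M A], the identity [N M = N] forces solutions to be sandwiched by [M], and on such [P]
    both operators agree. *)
Lemma lyap_solution A E M Q : projects_along E M -> quotient_decay A M ->
    M^T *m Q *m M = Q ->
  exists P, M^T *m P *m M = P /\ lyap_eq A P Q.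
Proof.
move=> ME MA QM; have AE := quotient_decay_invariant ME MA.
have [N NE] : exists N, N = M *m A by exists (M *m A).
have NM : N *m M = N by have := proj_mulmx_exp 1 ME AE; rewrite expr1 -NE.
have MN : M^T *m N^T = N^T by rewrite -trmx_mul NM.
pose f P := P - N^T *m P *m N.
have f_lin : linear f.
  move=> a P P'; rewrite /f mulmxDr mulmxDl -scalemxAr -scalemxAl scalerBr.
  by rewrite opprD addrACA.
pose fL := GRing.isLinear.Build _ _ _ _ f f_lin.
pose F : {linear 'M[R]_d -> 'M[R]_d} := HB.pack f fL.
have sandwich P Q' : M^T *m Q' *m M = Q' -> f P = Q' -> M^T *m P *m M = P.
  move=> Q'M /eqP; rewrite /f subr_eq => /eqP PE; rewrite {1}PE mulmxDr mulmxDl Q'M.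
  by rewrite [RHS]PE !mulmxA MN -(mulmxA _ _ M) NM.
have lyapE P Q' : M^T *m P *m M = P -> f P = Q' -> A^T *m P *m A = P - Q'.
  by move=> PM <-; rewrite /f opprB addrC subrK -{1}PM NE trmx_mul !mulmxA.
have F_inj : lker (linfun F) == 0%VS.
  apply/lker0P => P1 P2 /eqP; rewrite !lfunE -subr_eq0 -linearB => /eqP.
  move: (P1 - P2) (subr_eq0 P1 P2) => P PE fP; apply/eqP; rewrite -PE {PE}; apply/eqP.
  have PM : M^T *m P *m M = P by apply: sandwich fP; rewrite mulmx0 mul0mx.
  by apply: (lyap_fixed_eq0 MA PM); rewrite (lyapE _ _ PM fP) subr0.
exists ((linfun F)^-1%VF Q).
have fP : f ((linfun F)^-1%VF Q) = Q.
  by have := lker0_lfunVK F_inj Q; rewrite lfunE.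
have PM := sandwich _ _ QM fP; split=> //.
by rewrite /lyap_eq (lyapE _ _ PM fP) addrAC subrK subrr.
Qed.

Lemma quotient_decay_stmt5 A E M : projects_along E M ->
  quotient_decay A M -> stmt5 A E.
Proof.
move=> ME MA Q Q_psd; have QM := psd_ker_sandwich ME Q_psd.
have [QT Q0 QE] := Q_psd.
have [P [PM PQ]] := lyap_solution ME MA QM.
have uniq P' : M^T *m P' *m M = P' -> lyap_eq A P' Q -> P' = P.
  move=> P'M P'Q; apply/eqP; rewrite -subr_eq0; apply/eqP.
  apply: (lyap_fixed_eq0 MA); first by rewrite mulmxBr mulmxBl P'M PM.
  have lyapE P1 : lyap_eq A P1 Q -> A^T *m P1 *m A = P1 - Q.
    rewrite /lyap_eq -addrA => /eqP; rewrite addr_eq0 => /eqP->.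
    by rewrite opprD opprK.
  by rewrite mulmxBr mulmxBl !lyapE// opprB addrA subrK.
exists P; split; last by move=> P' P'_psd; apply: uniq; exact: psd_ker_sandwich P'_psd.
split=> //.
(* The transpose solves the same equation, so uniqueness gives symmetry. *)
have PT : P^T = P.
  apply: uniq; first by rewrite -[in RHS]PM !trmx_mul trmxK mulmxA.
  rewrite /lyap_eq -[RHS]trmx0 -[in RHS]PQ !linearD /= linearN /= !trmx_mul.
  by rewrite trmxK QT mulmxA.
have P0 x : 0 <= quad_form P x.
  have [K [s [s01 PK]]] := quotient_decay_form MA PM.
  rewrite -oppr_le0; apply: (le0_of_geometric_bound (C := K * `|M *m x| * `|M *m x|) s01) => k.
  apply: le_trans (PK k x x); rewrite lerNl.
  apply: (@le_trans _ _ (quad_form P (A ^+ k *m x))); first by rewrite lerNnormlW.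
  elim: k => [|k IHk]; first by rewrite expr0 mul1mx.
  rewrite exprS -[A * _]/(A *m _) -(mulmxA A) (le_trans _ IHk)//.
  by rewrite [leRHS](lyap_form _ PQ) lerDl; exact: Q0.
split=> // x; split=> [Px|xE].
  (* If [P x = 0], the equation makes the form of [Q] at [x] the negative of that of [P] at [A x],
     hence nonpositive. *)
  apply/QE/psd_form_eq0 => //; apply/eqP; rewrite eq_le Q0 andbT.
  have := lyap_form x PQ; rewrite {1}/quad_form /bilin_form -mulmxA Px mulmx0 mxE => /eqP.
  by rewrite eq_sym addrC addr_eq0 => /eqP->; rewrite oppr_le0.
by rewrite -PM -mulmxA (ME.2 x).2// mulmx0.
Qed.

(** The matrix [M^T M] supplies a [Q] with kernel [E] to which (5) applies. *)
Lemma stmt5_stmt4 A E : stmt5 A E -> stmt4 A E.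
Proof.
have [M ME] := projects_along_exists E.
have Q_psd : psd_ker E (M^T *m M).
  split=> [|x|x]; first by rewrite trmx_mul trmxK.
    rewrite -mulmxA -mulmxA mulmxA -trmx_mul mxE.
    by apply: sumr_ge0 => i _; rewrite mxE -expr2 sqr_ge0.
  rewrite -(ME.2 x); split=> [MMx|Mx]; last by rewrite -mulmxA Mx mulmx0.
  apply: dot_eq0; rewrite trmx_mul -mulmxA (mulmxA M^T) MMx mulmx0.
  by rewrite mxE.
by move=> /(_ _ Q_psd)[P [[P_psd PQ] _]]; exists P, (M^T *m M).
Qed.

(* Pairing with [w := (A - lam) z], which lies in the kernel by induction, the
   Hermitian form of [P] at [A z] is [|lam|^2] times that at [z], so that of
   [Q] at [z] is [(1 - |lam|^2)] times it, hence nonpositive. *)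
Lemma lyap_ge1_eigvec A P Q E z : psd_ker E P -> psd_ker E Q -> lyap_eq A P Q ->
  ge1_eigvec A z -> cplx_mx P *m z = 0.
Proof.
move=> [PT P0 PE] [QT Q0 QE] PQ [[s t] [k [lam1]]].
have st1 : 1 <= s ^+ 2 + t ^+ 2.
  move: lam1; rewrite -(@ler_pXn2r _ 2)// ?nnegrE// expr1n -add_Re2_Im2 /=.
  by rewrite -[1]/(1%:C)%C lecR.
have PsymE x y : P *m y = 0 -> quad_form P (x + y) = quad_form P x.
  move=> Py; have Pz z' : bilin_form P z' y = 0.
    by rewrite /bilin_form -mulmxA Py mulmx0 mxE.
  by rewrite /quad_form !bilin_formE (bilin_formC y x PT) !Pz !addr0.
elim: k z => [|k IHk] z; first by rewrite expr0 mul1mx => ->; rewrite mulmx0.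
rewrite exprSr -[_ * _]/(_ *m _) -mulmxA => /IHk.
have [a [b ->]] := cplx_pairP z.
have [u [v wE]] := cplx_pairP ((cplx_mx A - (Complex s t)%:M) *m cplx_pair a b).
rewrite wE mul_cplx_pair -cplx_pair0 => /cplx_pair_inj[Pu Pv].
move: wE; rewrite mulmxBl mul_scalar_mx => /eqP; rewrite subr_eq => /eqP.
rewrite !mul_cplx_pair cplx_pairZ cplx_pairD => /cplx_pair_inj[Aa Ab].
(* For symmetric [Q] this sum is the Hermitian form at [a + i b]. *)
have Qab : quad_form Q a + quad_form Q b <= 0.
  have Ea := lyap_form a PQ; have Eb := lyap_form b PQ.
  rewrite Aa (addrC u) PsymE// in Ea; rewrite Ab (addrC v) PsymE// in Eb.
  have rot : quad_form P (s *: a - t *: b) + quad_form P (s *: b + t *: a) =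
      (s ^+ 2 + t ^+ 2) * (quad_form P a + quad_form P b).
    by rewrite -!scaleNr /quad_form !bilin_formE; ring.
  have Pab : 0 <= quad_form P a + quad_form P b by apply: addr_ge0; exact: P0.
  have : 0 <= (s ^+ 2 + t ^+ 2 - 1) * (quad_form P a + quad_form P b).
    by rewrite mulr_ge0// subr_ge0.
  by rewrite mulrBl mul1r -rot; lra.
have [Qa Qb] : quad_form Q a = 0 /\ quad_form Q b = 0.
  by split; apply/eqP; rewrite eq_le Q0 andbT (le_trans _ Qab)// ?lerDl ?lerDr; exact: Q0.
congr cplx_pair;
  by apply/PE/QE/psd_form_eq0.
Qed.

Lemma stmt4_stmt1 A E : stmt4 A E -> stmt1 A E.
Proof.
move=> [P [Q [P_psd [Q_psd PQ]]]]; have [PT P0 PE] := P_psd.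
have [QT Q0 QE] := Q_psd.
split=> x.
  (* For [x] in [E] the form of [P] at [x] is 0, and it is the sum of two nonnegative terms, one of
     them the form of [P] at [A x]. *)
  move=> xE; apply/PE/psd_form_eq0 => //; apply/eqP; rewrite eq_le P0 andbT.
  have := lyap_form x PQ; rewrite {1}/quad_form /bilin_form -mulmxA (PE x).2// mulmx0 mxE => /eqP.
  by rewrite eq_sym addr_eq0 => /eqP->; rewrite oppr_le0; exact: Q0.
move=> /in_Ege1P Ax; apply/PE.
have : cplx_mx P *m cplx_mx x = 0.
  elim: Ax => [|y z _ IHy _ IHz|z]; first by rewrite mulmx0.
    by rewrite mulmxDr IHy IHz addr0.
  exact: lyap_ge1_eigvec P_psd Q_psd PQ.
by rewrite -cplx_mxM cplx_mxE -cplx_pair0 => /cplx_pair_inj[].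
Qed.

End Lyapunov.

(** * The equivalences and the smallest subspace *)

Theorem theorem2 (R : realType) (d : nat) (A : 'M[R]_d) :
  (forall E : {vspace 'cV[R]_d},
     [<-> stmt1 A E; stmt2 A E; stmt3 A E; stmt4 A E; stmt5 A E]) /\
  (exists E0 : {vspace 'cV[R]_d},
     (forall x, x \in E0 <-> in_Ege1 A x) /\
     (forall S, S = @stmt1 R d \/ S = @stmt2 R d \/ S = @stmt3 R d \/
                S = @stmt4 R d \/ S = @stmt5 R d ->
        S A E0 /\ (forall E : {vspace 'cV[R]_d}, S A E -> (E0 <= E)%VS))).
Proof.
have tfae E : [<-> stmt1 A E; stmt2 A E; stmt3 A E; stmt4 A E; stmt5 A E].
  have [M ME] := projects_along_exists E.
  have stmt1_5 : stmt1 A E -> stmt5 A E.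
    by move=> A1; apply/(quotient_decay_stmt5 ME)/(stmt1_quotient_decay ME).
  have stmt2_3 : stmt2 A E -> stmt3 A E.
    by move=> A2; apply/(quotient_decay_stmt3 ME)/(stmt2_quotient_decay ME).
  have stmt3_1 : stmt3 A E -> stmt1 A E.
    move=> /stmt3_stmt2/(stmt2_quotient_decay ME) MA.
    by apply/stmt4_stmt1/stmt5_stmt4/(quotient_decay_stmt5 ME).
  tfae.
  - by move=> A1; apply/stmt3_stmt2/(quotient_decay_stmt3 ME)/(stmt1_quotient_decay ME).
  - exact: stmt2_3.
  - by move=> A3; apply/stmt5_stmt4/stmt1_5/stmt3_1.
  - by move=> A4; apply/stmt1_5/stmt4_stmt1.
  - by move=> A5; apply/stmt4_stmt1/stmt5_stmt4.
split=> //.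
have [E0 E0P] : exists E0 : {vspace 'cV[R]_d}, forall x, x \in E0 <-> in_Ege1 A x.
  apply: vspace_of_submodule => [|x y|a x].
  - by apply/in_Ege1P; rewrite cplx_mxE cplx_pair0; exact: ge1_span0.
  - move=> /in_Ege1P Ax /in_Ege1P Ay; apply/in_Ege1P.
    by rewrite /cplx_mx map_mxD; exact: ge1_spanD.
  - move=> /in_Ege1P Ax; apply/in_Ege1P.
    by rewrite /cplx_mx map_mxZ; exact: ge1_spanZ.
exists E0; split=> // S Scase.
have SE E : S A E <-> stmt1 A E.
  (* Treats the five choices of [S] at once: its position [i] selects the instance of the
     equivalences that links it to (1), at position 0. *)
  have [i ->] : exists i, S A E = nth (stmt1 A E)
    [:: stmt1 A E; stmt2 A E; stmt3 A E; stmt4 A E; stmt5 A E] i.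
    by case: Scase => [|[|[|[|]]]] ->;
      [exists 0%N|exists 1%N|exists 2%N|exists 3%N|exists 4%N].
  exact: (tfae E i 0%N).
split=> [|E /SE[_ EP]]; last by apply/subvP => x /E0P; exact: EP.
by apply/SE; split=> x /E0P // Ax; apply/E0P/in_Ege1_mulmx.
Qed.
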